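(* Let $(M,Z)$ be a relative $C^1$ manifold and let $f\colon(M,Z)\to([0,\infty),\{0\})$ be a relative $C^1$ function. Suppose that there exist $\rho>0$ and a continuous function $b\colon(0,\rho]\to(0,\infty)$ with $\int_0^\rho\frac{1}{b(t)}\,dt=\infty$ such that $$|\nabla_xf|\leq b(f(x))\quad\text{for all }x\in f^{-1}((0,\rho)).$$ Let $p\in\partial Z$. Then there exists no rectifiable curve $\gamma\colon([0,\varepsilon],\{0\})\to(M,Z)$ (with $\varepsilon>0$) such that $\gamma(0)=p$.
   Context: Relative manifolds. A relative $C^k$ manifold ($k\geq 1$) is a pair $(M,Z)$ where $(M,d)$ is a connected, locally compact metric space (not necessarily complete), $Z\subset M$ is a nonempty, closed, proper subset, and $M\setminus Z$ is a $C^k$ manifold of dimension $n\geq1$. It is assumed that the restriction of $d$ to $M\setminus Z$ comes from a Riemannian metric on $M\setminus Z$; gradients and norms of tangent vectors are taken with respect to this Riemannian metric. $\partial$ denotes topological boundary. A relative function $(A_1,B_1)\to(A_2,B_2)$ between pairs ($B_i\subset A_i$) is a map $A_1\to A_2$ sending $B_1$ into $B_2$ and $A_1\setminus B_1$ into $A_2\setminus B_2$. A relative $C^1$ function (or curve) is a continuous relative function whose restriction to $A_1\setminus B_1$ is of class $C^1$. A relative $C^1$ curve $\gamma\colon([0,\varepsilon],\{0\})\to(M,Z)$ with $\gamma(0)=p\in\partial Z$ (so $\gamma(t)\in M\setminus Z$ for $t>0$) is called rectifiable if $\int_0^\varepsilon|\gamma'(t)|\,dt<\infty$. *)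

(* Defs.v *)
From HB Require Import structures.
From mathcomp Require Import all_boot all_order all_algebra.
From mathcomp Require Import all_classical all_reals all_analysis.
Import Order.TTheory GRing.Theory Num.Theory.
Import numFieldNormedType.Exports.

Set Implicit Arguments.
Unset Strict Implicit.
Unset Printing Implicit Defensive.

Local Open Scope classical_set_scope.
Local Open Scope ring_scope.

(* A C^1 map on an open set U: differentiable with continuous differential.
   In finite dimension, continuity of x |-> Dh(x) is continuity of
   x |-> Dh(x) v for each v. *)
Definition C1_on (R : realType) (V W : normedModType R) (U : set V)
    (h : V -> W) :=
  (forall x, U x -> differentiable h x) /\
  (forall v, {within U, continuous ('D_v h)}).

(* Difference quotients are taken inside S, hence one-sided at an endpoint
   of an interval S. *)
Definition diff_quot (R : realType) (V : normedModType R) (S : set R)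
    (u : R -> V) (t : R) : set_system V :=
  (fun s => (s - t)^-1 *: (u s - u t)) @ within S t^'.

Definition vel (R : realType) (V : normedModType R) (S : set R)
    (u : R -> V) (t : R) : V := lim (diff_quot S u t).

Definition C1_within (R : realType) (V : normedModType R) (S : set R)
    (u : R -> V) :=
  (forall t, S t -> cvg (diff_quot S u t)) /\ {within S, continuous (vel S u)}.

Record chart (R : realType) (n : nat) (M : metricType R) := Chart {
  cdom : set M ;
  cmap : M -> 'rV[R]_n ;
  cinv : 'rV[R]_n -> M
}.

Definition cim (R : realType) (n : nat) (M : metricType R) (c : chart n M) :
  set 'rV[R]_n := cmap c @` cdom c.

Definition is_chart (R : realType) (n : nat) (M : metricType R) (O : set M)
    (c : chart n M) :=
  [/\ open (cdom c) /\ cdom c `<=` O,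
      open (cim c),
      (forall x, cdom c x -> cinv c (cmap c x) = x),
      {within cdom c, continuous (cmap c)} &
      {within cim c, continuous (cinv c)}].

Definition transition (R : realType) (n : nat) (M : metricType R)
    (c c' : chart n M) : 'rV[R]_n -> 'rV[R]_n := cmap c' \o cinv c.

(* A C^1 manifold structure of dimension n on the open subset O of M, given by
   an atlas.  Hausdorffness comes from the metric; second countability, from
   the connectedness and local compactness of M in rel_manifold below.
   The preferred chart chart_at x is used to represent tangent vectors at x as
   elements of 'rV_n. *)
Record C1_atlas (R : realType) (n : nat) (M : metricType R) (O : set M) :=
  C1Atlas {
  charts : set (chart n M) ;
  chart_at : M -> chart n M ;
  chartsP : forall c, charts c -> is_chart O c ;
  chart_atP : forall x, O x -> charts (chart_at x) /\ cdom (chart_at x) x ;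
  charts_compat : forall c c', charts c -> charts c' ->
    C1_on (cmap c @` (cdom c `&` cdom c')) (transition c c')
}.

Definition mxform (R : realType) (n : nat) (G : 'M[R]_n) (u v : 'rV[R]_n) : R :=
  (u *m G *m v^T) 0 0.

(* gmx c x is the matrix, in the chart c, of the inner product on the tangent
   space at x.  Tangent vectors are row vectors, so they are transported from c
   to c' by right multiplication with the Jacobian of the transition map.  On a
   C^1 manifold the transformation rule allows no more regularity than
   continuity of the coefficients. *)
Record riemannian (R : realType) (n : nat) (M : metricType R) (O : set M)
    (A : C1_atlas n O) := Riemannian {
  gmx : chart n M -> M -> 'M[R]_n ;
  gmx_sym : forall c x, charts A c -> cdom c x -> (gmx c x)^T = gmx c x ;
  gmx_pos : forall c x, charts A c -> cdom c x ->
    forall v, v != 0 -> 0 < mxform (gmx c x) v v ;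
  gmx_continuous : forall c, charts A c -> {within cdom c, continuous (gmx c)} ;
  gmx_compat : forall c c' x, charts A c -> charts A c' ->
    cdom c x -> cdom c' x ->
    let J := jacobian (transition c c') (cmap c x) in
    gmx c x = J *m gmx c' x *m J^T
}.

Section RelManifold.
Context (R : realType) (n : nat) (M : metricType R).
Implicit Types (O Z S : set M).

Definition tinner O (A : C1_atlas n O) (g : riemannian A) (x : M)
    (u v : 'rV[R]_n) : R := mxform (gmx g (chart_at A x) x) u v.

Definition tnorm O (A : C1_atlas n O) (g : riemannian A) (x : M)
    (v : 'rV[R]_n) : R := Num.sqrt (tinner g x v v).

Definition tdiff O (A : C1_atlas n O) (f : M -> R) (x : M) (v : 'rV[R]_n) : R :=
  'D_v (f \o cinv (chart_at A x)) (cmap (chart_at A x) x).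

(* The classical coordinate expression; grad_spec below characterizes it. *)
Definition grad O (A : C1_atlas n O) (g : riemannian A) (f : M -> R) (x : M) :
    'rV[R]_n :=
  (\row_i tdiff A f x (delta_mx 0 i)) *m invmx (gmx g (chart_at A x) x).

Definition C1_fun O (A : C1_atlas n O) (f : M -> R) :=
  forall c, charts A c -> C1_on (cim c) (f \o cinv c).

(* The domain I of gamma is an interval and gamma is meant to be continuous on
   I, so that I `&` gamma @^-1` cdom c is relatively open in I. *)
Definition C1_curve O (A : C1_atlas n O) (I : set R) (gamma : R -> M) :=
  (forall t, I t -> O (gamma t)) /\
  (forall c, charts A c ->
    C1_within (I `&` gamma @^-1` cdom c) (cmap c \o gamma)).

Definition speed O (A : C1_atlas n O) (g : riemannian A) (I : set R)
    (gamma : R -> M) (t : R) : R :=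
  tnorm g (gamma t) (vel I (cmap (chart_at A (gamma t)) \o gamma) t).

Definition arc_length O (A : C1_atlas n O) (g : riemannian A) (I : set R)
    (gamma : R -> M) : \bar R :=
  (\int[lebesgue_measure]_(t in I) (speed g I gamma t)%:E)%E.

(* Infimum of the lengths of C^1 curves in O from x to y (+oo if there is
   none).  Curves need not be regular: a piecewise C^1 curve can be
   reparametrized, with zero speed at its corners, into a C^1 one of the same
   length, so piecewise C^1 curves would give the same value. *)
Definition gdist O (A : C1_atlas n O) (g : riemannian A) (x y : M) : \bar R :=
  ereal_inf [set l | exists gamma : R -> M,
    [/\ {within `[0, 1], continuous gamma}, C1_curve A `[0, 1] gamma,
        gamma 0 = x, gamma 1 = y & l = arc_length g `[0, 1] gamma]].

(* The last clause says that d restricted to M \ Z comes from g.  It is local,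
   because curves in M \ Z cannot in general realize the distance between
   distant points (Z may even disconnect M). *)
Definition rel_manifold Z (A : C1_atlas n (~` Z)) (g : riemannian A) :=
  [/\ (0 < n)%N,
      connected [set: M] /\ locally_compact [set: M],
      closed Z,
      Z !=set0 /\ Z != setT &
      forall p, ~ Z p -> exists2 U, nbhs p U &
        forall x y, U x -> U y -> (mdist x y)%:E = gdist g x y].

Definition rel_C1_fun Z (A : C1_atlas n (~` Z)) (f : M -> R) :=
  [/\ continuous f, (forall x, Z x -> f x = 0), (forall x, ~ Z x -> 0 < f x) &
      C1_fun A f].

Definition rel_C1_curve Z (A : C1_atlas n (~` Z)) (eps : R) (gamma : R -> M) :=
  [/\ {within `[0, eps], continuous gamma}, Z (gamma 0) &
      C1_curve A `]0, eps] gamma].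

Definition rectifiable Z (A : C1_atlas n (~` Z)) (g : riemannian A) (eps : R)
    (gamma : R -> M) := (arc_length g `]0%R, eps] gamma < +oo)%E.

Definition boundary S : set M := closure S `\` interior S.

Lemma gmx_unit O (A : C1_atlas n O) (g : riemannian A) c x :
  charts A c -> cdom c x -> gmx g c x \in unitmx.
Proof.
move=> Ac cx; rewrite -row_free_unit -kermx_eq0; apply/rowV0P => v.
move=> /sub_kermxP vG; apply/eqP; apply: contraT => v0.
by have := gmx_pos g Ac cx v0; rewrite /mxform vG mul0mx mxE ltxx.
Qed.

Lemma grad_spec O (A : C1_atlas n O) (g : riemannian A) (f : M -> R) x :
  C1_fun A f -> O x -> forall v, tinner g x (grad g f x) v = tdiff A f x v.
Proof.
move=> fC1 Ox v; have [Ac cx] := chart_atP A Ox.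
have df : differentiable (f \o cinv (chart_at A x)) (cmap (chart_at A x) x).
  by have [+ _] := fC1 _ Ac; apply; exists x.
rewrite /tinner /mxform /grad mulmxKV ?gmx_unit// /tdiff deriveE//.
rewrite [in RHS](row_sum_delta v) linear_sum mxE; apply: eq_bigr => i _.
by rewrite linearZ /= !mxE deriveE// mulrC.
Qed.

End RelManifold.

(* Main.v *)
Require Import Defs.
From HB Require Import structures.
From mathcomp Require Import all_boot all_order all_algebra.
From mathcomp Require Import all_classical all_reals all_analysis.
From mathcomp Require Import measurable_realfun.
Import Order.TTheory GRing.Theory Num.Theory.
Import numFieldNormedType.Exports.

(** This is the Osgood uniqueness argument, read off along a curve.

    Let gamma start in Z at time 0 and stay outside Z afterwards, and put
    u := f o gamma, so that u 0 = 0 and u > 0 on ]0, eps].  At an interior time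
    t the chain rule gives u' t = <grad f, gamma' t>, hence by Cauchy-Schwarz
    and the bound on the gradient |u' t| <= b (u t) |gamma' t| as soon as
    u t < rho ([derive_along_curve_bound]).  Dividing by b (u t) and
    integrating, the arc length between two times t1 < t2 is at least the
    integral of 1 / b between u t1 and u t2 ([le_integral_along_curve]).  Fix
    t2 small.  As u is continuous with u 0 = 0, the value u t1 can be any
    number in ]0, u t2[, and the integral of 1 / b from x to u t2 is unbounded
    as x tends to 0 ([integral_oc_pinfty_unbounded]).  The arc length is
    therefore infinite ([osgood]).

    The speed of gamma is a priori defined in a chart that changes with the
    point, which makes its measurability awkward.  This is avoided: the arc
    length only has to be bounded below by the integral of the continuous
    function |u'| / b(u), and for nonnegative integrands the integral is a
    supremum over simple functions, hence monotone without any measurability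
    ([ge0_le_subset_integral]). *)

Set Implicit Arguments.
Unset Strict Implicit.
Unset Printing Implicit Defensive.

Local Open Scope classical_set_scope.
Local Open Scope ring_scope.

(** * Integral estimates on the line *)

(** The integral of a nonnegative function is by definition the supremum of the
    integrals of the simple functions below it, which is monotone in the
    function; this serves for a majorant h of unknown measurability. *)
Lemma ge0_le_subset_integral (d : measure_display) (T : measurableType d)
    (R : realType) (mu : {measure set T -> \bar R}) (D E : set T)
    (f h : T -> \bar R) :
  D `<=` E -> (forall x, D x -> 0 <= f x <= h x)%E ->
  (forall x, E x -> 0 <= h x)%E ->
  (\int[mu]_(x in D) f x <= \int[mu]_(x in E) h x)%E.
Proof.
move=> DE fh h0.
rewrite !ge0_integralE//; last by move=> x /fh/andP[].
apply: ereal_sup_le => _ [k /= kf <-]; exists k => // x.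
apply: le_trans (kf x) _; rewrite !patchE; case: ifPn => [|_].
  by rewrite inE => Dx; have /andP[_] := fh x Dx; rewrite mem_set//; apply: DE.
by case: ifPn => // /[!inE] /h0.
Qed.

Section osgood.
Context {R : realType}.
Notation mu := (@lebesgue_measure R).

Lemma derivable_cc_LRcontinuous (F : R -> R) (x y : R) : x < y ->
  (forall t, x <= t <= y -> derivable F t 1) -> derivable_oo_LRcontinuous F x y.
Proof.
move=> xy dF; split.
- by move=> t; rewrite in_itv/= => /andP[xt ty]; apply: dF; rewrite !ltW.
- apply: cvg_at_right_filter; apply: differentiable_continuous.
  by apply/derivable1_diffP/dF; rewrite lexx ltW.
- apply: cvg_at_left_filter; apply: differentiable_continuous.
  by apply/derivable1_diffP/dF; rewrite lexx ltW.
Qed.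

(** Substitution x = u t in the integral of h, without monotonicity of u: if F
    is an antiderivative of h, both F (u t2) - F (u t1) and the integral of
    (F o u)' = h(u) u' over [t1, t2] compute the left-hand side, and s dominates
    the absolute value of the latter integrand.  For h = 1 / b, the last
    hypothesis reads |u'| <= b(u) s. *)
Lemma le_integral_along_curve (h u s : R -> R) (rho t1 t2 : R) (I : set R) :
  (forall x, 0 < x < rho -> 0 < h x) ->
  (forall x, 0 < x < rho -> {for x, continuous h}) ->
  t1 < t2 -> `[t1, t2] `<=` I -> u t1 < u t2 ->
  (forall t, I t -> 0 <= s t) ->
  (forall t, t1 <= t <= t2 ->
    [/\ derivable u t 1, {for t, continuous u^`()%classic}, 0 < u t < rho &
        h (u t) * `|u^`()%classic t| <= s t]) ->
  (\int[mu]_(x in `[u t1, u t2]) (h x)%:E <= \int[mu]_(t in I) (s t)%:E)%E.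
Proof.
move=> h0 hc t12 subI u12 s0 ut.
have uc : forall t, t1 <= t <= t2 -> {for t, continuous u}.
  move=> t /ut[du _ _ _]; apply: differentiable_continuous.
  exact/derivable1_diffP.
have [m mt umin] : exists2 c, c \in `[t1, t2]%R &
    forall t, t \in `[t1, t2]%R -> u c <= u t.
  apply: EVT_min; first exact: ltW.
  apply: continuous_in_subspaceT => t; rewrite inE/= in_itv/= => /uc.
  exact.
have /andP[um0 umrho] : 0 < u m < rho.
  by have [] := ut m _; rewrite // -in_itv/=.
(* As h may fail to be integrable near 0, its antiderivative F is based at a
   point a > 0; a is strictly below the values of u on [t1, t2], so that F is
   differentiable at each of them. *)
pose a := u m / 2; have a0 : 0 < a by rewrite divr_gt0.
have aum : a < u m by rewrite ltr_pdivrMr// ltr_pMr// ltr1n.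
pose F x := (\int[mu]_(y in `[a, x]) h y)%R.
have FE x : a < x < rho -> derivable F x 1 /\ F^`()%classic x = h x.
  move=> /andP[ax xrho].
  pose c := (x + rho) / 2; have [xc crho] := midf_lt xrho.
  apply: (@continuous_FTC1_closed _ h a x c) => //.
  - apply: continuous_compact_integrable; first exact: segment_compact.
    apply: continuous_in_subspaceT => t; rewrite inE/= in_itv/= => /andP[at1 tc].
    by apply: hc; rewrite (lt_le_trans a0)//= (le_lt_trans tc).
  - by apply: hc; rewrite xrho (lt_trans a0).
have uab t : t1 <= t <= t2 -> a < u t < rho.
  move=> tt; have [_ _ /andP[_ ->] _] := ut t tt; rewrite andbT.
  by rewrite (lt_le_trans aum)// umin// in_itv.
have FuE t : t1 <= t <= t2 -> derivable (F \o u) t 1 /\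
    (F \o u)^`()%classic t = h (u t) * u^`()%classic t.
  move=> tt; have [du _ _ _] := ut t tt; have [dF FE'] := FE _ (uab t tt).
  split; last by rewrite derive1_comp// FE'.
  by apply/derivable1_diffP/differentiable_comp; apply/derivable1_diffP.
have u12ab x : u t1 <= x <= u t2 -> a < x < rho.
  move=> /andP[u1 u2].
  have /andP[au1 _] : a < u t1 < rho by apply: uab; rewrite lexx ltW.
  have /andP[_ u2r] : a < u t2 < rho by apply: uab; rewrite lexx ltW.
  by rewrite (lt_le_trans au1)//= (le_lt_trans u2).
have -> : (\int[mu]_(x in `[u t1, u t2]) (h x)%:E =
    (F (u t2))%:E - (F (u t1))%:E)%E.
  apply: continuous_FTC2 => //.
  - apply: continuous_in_subspaceT => x; rewrite inE/= in_itv/= => /u12ab.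
    by move=> /andP[ax xr]; apply: hc; rewrite xr (lt_trans a0).
  - by apply: derivable_cc_LRcontinuous => // x /u12ab/FE[].
  - move=> x; rewrite in_itv/= => /andP[u1 u2].
    by apply: (FE _ _).2; apply: u12ab; rewrite !ltW.
pose w t := h (u t) * u^`()%classic t.
have wc : {within `[t1, t2], continuous w}.
  apply: continuous_in_subspaceT => t; rewrite inE/= in_itv/= => tt.
  have [_ u'c utr _] := ut t tt.
  apply: (@cvgM _ _ _ _ (h \o u) u^`()%classic) => //.
  by apply: continuous_comp; [exact: uc | exact: hc].
rewrite -(@continuous_FTC2 _ w (F \o u) t1 t2)//; last 2 first.
- by apply: derivable_cc_LRcontinuous => // t /FuE[].
- by move=> t; rewrite in_itv/= => /andP[? ?]; apply: (FuE t _).2; rewrite !ltW.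
have iw : mu.-integrable `[t1, t2] (EFin \o w).
  by apply: continuous_compact_integrable => //; exact: segment_compact.
apply: le_trans (lee_abs _) _.
apply: le_trans (le_abse_integral mu _ _) _ => //.
  by have /integrableP[] := iw.
apply: ge0_le_subset_integral => // t.
rewrite /= in_itv/= => tt; have [_ _ utr hs] := ut t tt.
by rewrite !lee_fin normr_ge0/= /w normrM gtr0_norm// h0.
Qed.

(** The part of the integral over ]c, rho] is finite, so all of the divergence
    sits at 0, where monotone convergence along [c / (i + 2), c] turns it into
    unboundedness of the integrals over [x, c]. *)
Lemma integral_oc_pinfty_unbounded (h : R -> R) (rho c : R) (L : \bar R) :
  0 < c <= rho -> (forall x, 0 < x <= rho -> 0 <= h x) ->
  {within `]0, rho], continuous h} ->
  (\int[mu]_(x in `]0%R, rho]) (h x)%:E = +oo)%E ->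
  (forall x, 0 < x < c -> (\int[mu]_(y in `[x, c]) (h y)%:E <= L)%E) ->
  L = +oo%E.
Proof.
move=> /andP[c0 crho] h0 hc hoo hL.
have mh : measurable_fun `]0, rho] (EFin \o h).
  apply/measurable_EFinP.
  by apply: subspace_continuous_measurable_fun.
have subc x : 0 < x -> `[x, c] `<=` `]0, rho].
  move=> x0 y /=; rewrite !in_itv/= => /andP[xy yc].
  by rewrite (lt_le_trans x0)//= (le_trans yc).
have h0E x : x \in `]0, rho]%R -> (0 <= (h x)%:E)%E.
  by rewrite in_itv/= lee_fin; exact: h0.
have hc0 : (\int[mu]_(x in `]0%R, c]) (h x)%:E <= L)%E.
  pose F (i : nat) := `[c / i.+2%:R, c]%classic : set R.
  have -> : `]0, c]%classic = \bigcup_i F i.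
    apply/seteqP; split=> [x /=|x [i _]]; rewrite /F /= !in_itv/=; last first.
      by case/andP => cx ->; rewrite (lt_le_trans _ cx)// divr_gt0.
    move=> /andP[x0 xc]; exists (Num.truncn (c / x)) => //=.
    rewrite in_itv/= xc andbT ler_pdivrMr// mulrC -ler_pdivrMr//.
    have /truncn_itv/andP[_ /ltW] : 0 <= c / x by rewrite divr_ge0// ltW.
    by move=> /le_trans; apply; rewrite ler_nat.
  have Fsub i : F i `<=` `]0, rho] by apply: subc; rewrite divr_gt0.
  have cvgF : (\int[mu]_(x in F i) (h x)%:E @[i --> \oo] -->
      \int[mu]_(x in \bigcup_i F i) (h x)%:E)%E.
    apply: ge0_nondecreasing_set_cvg_integral => //.
    - apply/nondecreasing_seqP => i; rewrite subsetEset => x.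
      rewrite /F /= !in_itv/= => /andP[cx ->]; rewrite andbT.
      by rewrite (le_trans _ cx)// ler_pM2l// lef_pV2 ?posrE// ler_nat.
    - by move=> i; exact: measurable_itv.
    - by move=> i; apply: measurable_funS mh.
    - by move=> i x /Fsub; exact: h0E.
  rewrite -(cvg_lim _ cvgF)//; apply: lime_le.
    by apply/cvg_ex; eexists; exact: cvgF.
  apply: nearW => i; apply: hL; rewrite divr_gt0//=.
  by rewrite ltr_pdivrMr// ltr_pMr// ltr1n.
have hcrho : (\int[mu]_(x in `[c, rho]) (h x)%:E < +oo)%E.
  have : mu.-integrable `[c, rho] (EFin \o h).
    apply: continuous_compact_integrable; first exact: segment_compact.
    apply: continuous_subspaceW hc => x /=; rewrite !in_itv/= => /andP[cx ->].
    by rewrite (lt_le_trans c0).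
  move=> /integrable_fin_num => /(_ (measurable_itv _)).
  by rewrite fin_num_abs => /(le_lt_trans (lee_abs _)).
have : (+oo <= L + \int[mu]_(x in `[c, rho]) (h x)%:E)%E.
  have -> : (+oo = \int[mu]_(x in `]0%R, c] `|` `]c, rho]) (h x)%:E)%E.
    rewrite -hoo; congr (integral _ _ _).
    apply/seteqP; split=> x /=; rewrite !in_itv/=.
      by move=> /andP[-> xr]; case: (leP x c) => xc; [left|right].
    by move=> [/andP[-> /le_trans]|/andP[cx ->]]; [apply|rewrite (lt_trans c0)].
  rewrite ge0_integral_setU//=; last 3 first.
  - apply: measurable_funS mh => // x [] /=; rewrite !in_itv/= => /andP[].
      by move=> -> /le_trans; apply.
    by move=> /(lt_trans c0) ->.
  - move=> x [] /=; rewrite in_itv/= => /andP[x1 x2]; apply: h0E; rewrite in_itv/=.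
      by rewrite x1 (le_trans x2).
    by rewrite x2 (lt_trans c0).
  - apply/disj_setPRL => x /=; rewrite !in_itv/= => /andP[cx _] /andP[_].
    by rewrite leNgt cx.
  rewrite leeD//; apply: ge0_subset_integral => //.
  - apply: measurable_funS mh => // x /=; rewrite !in_itv/= => /andP[cx ->].
    by rewrite (lt_le_trans c0).
  - move=> x /=; rewrite in_itv/= => /andP[x1 x2]; apply: h0E; rewrite in_itv/=.
    by rewrite x2 (lt_le_trans c0).
  - by move=> x /=; rewrite !in_itv/= => /andP[/ltW -> ->].
have : (0 <= \int[mu]_(x in `[c, rho]) (h x)%:E)%E.
  apply: integral_ge0 => x /=; rewrite in_itv/= => /andP[x1 x2].
  by apply: h0E; rewrite in_itv/= x2 (lt_le_trans c0).
move: hcrho; case: (\int[mu]_(x in `[c, rho]) _)%E => [r| |] //= _ _.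
by case: L {hL hc0} => [l| |].
Qed.

(** Osgood's criterion: a function u that leaves 0 at time 0 with
    |u'| <= b(u) s needs an infinite amount of s to do so.  Only the values of
    u below rho are controlled, so the argument takes place on an initial
    interval ]0, t0] on which u < rho. *)
Lemma osgood (b u s : R -> R) (rho eps : R) :
  0 < eps -> 0 < rho ->
  (forall x, 0 < x <= rho -> 0 < b x) ->
  {within `]0, rho], continuous b} ->
  (\int[mu]_(x in `]0%R, rho]) (b x)^-1%:E = +oo)%E ->
  {within `[0, eps], continuous u} -> u 0 = 0 ->
  (forall t, 0 < t <= eps -> 0 < u t) ->
  (forall t, 0 < t <= eps -> 0 <= s t) ->
  (forall t, 0 < t < eps -> [/\ derivable u t 1,
     {for t, continuous u^`()%classic} &
     u t < rho -> `|u^`()%classic t| <= b (u t) * s t]) ->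
  (\int[mu]_(t in `]0%R, eps]) (s t)%:E = +oo)%E.
Proof.
move=> eps0 rho0 b0 bc boo uc u00 u0 s0 ut.
have [t0 /andP[t00 t0eps] urho] : exists2 t0, 0 < t0 < eps &
    forall t, 0 < t <= t0 -> u t < rho.
  have /(continuous_within_itvP _ eps0)[_ + _] := uc.
  rewrite u00 => /cvgr_lt/(_ _ rho0).
  move=> [e /= e0 He]; exists (Num.min (e / 2) (eps / 2)).
    rewrite lt_min !divr_gt0//= gt_min [X in _ || X]ltr_pdivrMr//.
    by rewrite ltr_pMr// ltr1n orbT.
  move=> t /andP[t0]; rewrite le_min => /andP[te _]; apply: He => //=.
  rewrite sub0r normrN gtr0_norm// (le_lt_trans te)//.
  by rewrite ltr_pdivrMr// ltr_pMr// ltr1n.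
pose c := u t0.
have c0 : 0 < c by apply: u0; rewrite t00 ltW.
have crho : c < rho by apply: urho; rewrite t00 lexx.
have bcoo x : 0 < x < rho -> {for x, continuous (fun x => (b x)^-1)}.
  move=> /[dup] xr /andP[x0 xrho]; apply: cvgV.
    by rewrite gt_eqF// b0// x0 ltW.
  have : {within `]0, rho[, continuous b}.
    apply: continuous_subspaceW bc => y /=; rewrite !in_itv/= => /andP[-> /ltW].
    by [].
  rewrite continuous_open_subspace; last exact: itv_open.
  by apply; rewrite inE/= in_itv.
apply: (@integral_oc_pinfty_unbounded (fun x => (b x)^-1) rho c) => //.
- by rewrite c0 ltW.
- by move=> x /b0 bx; rewrite invr_ge0 ltW.
- apply/subspace_continuousP => x xr; apply: cvgV.
    by move: xr => /=; rewrite in_itv/= => /b0 bx; rewrite gt_eqF.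
  by have /subspace_continuousP := bc; apply.
move=> x /andP[x0 xc].
(* x lies between u 0 = 0 and u t0 = c, so it is a value of u. *)
have [t1] : exists2 t1, t1 \in `[0, t0] & u t1 = x.
  apply: IVT; first exact: ltW.
    apply: continuous_subspaceW uc => t /=; rewrite !in_itv/= => /andP[-> ?].
    by rewrite (le_trans _ (ltW t0eps)).
  by rewrite u00 min_l ?max_r ?ltW.
rewrite in_itv/= => /andP[]; rewrite le_eqVlt => /predU1P[<- _|t10].
  by rewrite u00 => x00; move: x0; rewrite -x00 ltxx.
rewrite le_eqVlt => /predU1P[->|t1t0] ux.
  by move: xc; rewrite -ux ltxx.
rewrite -ux; apply: (@le_integral_along_curve (fun x => (b x)^-1) u s rho) => //.
- by move=> y /andP[y0 yr]; rewrite invr_gt0 b0// y0 ltW.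
- move=> t /=; rewrite !in_itv/= => /andP[t1t tt0].
  by rewrite (lt_le_trans t10)//= (le_trans tt0 (ltW _)).
- by rewrite ux.
move=> t /andP[t1t tt0].
have tp : 0 < t by rewrite (lt_le_trans t10).
have te : t < eps by rewrite (le_lt_trans tt0).
have [du u'c uless] := ut t (introT andP (conj tp te)).
have utr : u t < rho by apply: urho; rewrite tp.
have ut0 : 0 < u t by apply: u0; rewrite tp ltW.
split => //; first by rewrite ut0.
have bu0 : 0 < b (u t) by apply: b0; rewrite ut0 ltW.
by rewrite ler_pdivrMl//; exact: uless.
Qed.

End osgood.

(** * The Cauchy-Schwarz inequality for a Riemannian metric *)

Lemma mxform_cauchy_schwarz (R : realType) (n : nat) (G : 'M[R]_n)
    (u v : 'rV[R]_n) :
  G^T = G -> (forall w, w != 0 -> 0 < mxform G w w) ->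
  `|mxform G u v| <= Num.sqrt (mxform G u u) * Num.sqrt (mxform G v v).
Proof.
move=> Gsym Gpos.
have formC x y : mxform G x y = mxform G y x.
  rewrite /mxform; suff -> : x *m G *m y^T = (y *m G *m x^T)^T by rewrite mxE.
  by rewrite !trmx_mul trmxK Gsym mulmxA.
have formB a c x y z :
    mxform G (a *: x - c *: y) z = a * mxform G x z - c * mxform G y z.
  by rewrite /mxform !mulmxBl -!scalemxAl !mxE.
have form_ge0 x : 0 <= mxform G x x.
  have [->|/Gpos/ltW//] := eqVneq x 0.
  by rewrite /mxform !mul0mx mxE.
have [->|v0] := eqVneq v 0.
  by rewrite [in leLHS]formC /mxform !mul0mx mxE normr0 mulr_ge0.
rewrite -sqrtrM// -sqrtr_sqr ler_wsqrtr//.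
set a := mxform G v v; set c := mxform G u v; set e := mxform G u u.
have a0 : 0 < a by exact: Gpos.
(* a *: u - c *: v is a times the component of u orthogonal to v. *)
have : 0 <= a * (a * e - c ^+ 2).
  suff -> : a * (a * e - c ^+ 2) =
      mxform G (a *: u - c *: v) (a *: u - c *: v) by [].
  rewrite formB [mxform G u _]formC [mxform G v _]formC !formB.
  rewrite [mxform G v u]formC -/a -/c -/e.
  by rewrite [c * a]mulrC subrr mulr0 subr0 expr2.
by rewrite pmulr_rge0// subr_ge0 mulrC.
Qed.

(** * Derivatives of a function along a curve *)

(** Near an interior point of S, restricting the increments to S changes
    nothing: one-sidedness only shows at boundary points. *)
Lemma diff_quot_interior (R : realType) (V : normedModType R) (S : set R)
    (u : R -> V) (t : R) : nbhs t S ->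
  diff_quot S u t = (fun h => h^-1 *: ((u \o shift t) (h *: 1) - u t)) @ 0^'.
Proof.
move=> St; rewrite /diff_quot; apply/funext => P; apply/propext.
rewrite /= !near_simpl/= !near_withinE.
apply: (iff_trans (@nbhs0P R R^o
  (fun s => s != t -> S s -> P ((s - t)^-1 *: (u s - u t))) t)).
have St0 := (@nbhs0P R R^o S t).1 St.
have shiftE h : (t + h - t)^-1 *: (u (t + h) - u t) =
    h^-1 *: ((u \o shift t) (h *: 1) - u t).
  by rewrite [t + h]addrC addrK /= /GRing.scale /= mulr1.
have h0E h : (t + h != t) = (h != 0) by rewrite -subr_eq0 [t + h]addrC addrK.
split=> H; apply: filterS2 St0 H => h Sth Hh hn0.
  by have := Hh; rewrite h0E shiftE; apply.
by rewrite shiftE => _; apply: Hh; rewrite -h0E.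
Qed.

Section interior_velocity.
Context {R : realType} {V : normedModType R}.
Implicit Types (S : set R) (u : R -> V) (t : R).

Lemma vel_interior S u t : nbhs t S -> vel S u t = 'D_1 u t.
Proof. by move=> St; rewrite /vel diff_quot_interior. Qed.

Lemma C1_within_interior S u t : nbhs t S -> C1_within S u ->
  derivable u t 1 /\ {for t, continuous ('D_1 u)}.
Proof.
move=> St [du cu]; split.
  by have := du t (nbhs_singleton St); rewrite diff_quot_interior.
have : vel S u s @[s --> t] --> vel S u t.
  by have := cu t; rewrite /continuous_at -nbhs_subspace_interior.
rewrite vel_interior// => cvt; apply: cvg_trans cvt; apply: near_eq_cvg.
by apply: filterS (nbhs_interior St) => s /vel_interior.
Qed.

End interior_velocity.

Lemma derive_coordE (R : realType) (n : nat) (F : 'rV[R]_n -> R)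
    (y v : 'rV[R]_n) : differentiable F y ->
  'D_v F y = \sum_(i < n) v 0 i * 'D_(delta_mx 0 i) F y.
Proof.
move=> dF; rewrite deriveE// [in LHS](row_sum_delta v) linear_sum.
by apply: eq_bigr => i _; rewrite linearZ /= deriveE.
Qed.

Section curve_in_manifold.
Context {R : realType} {n : nat} {M : metricType R} {O : set M}.
Context {A : C1_atlas n O}.

Lemma near_curve_chart (eps : R) (gamma : R -> M) (c : chart n M) (t : R) :
  {within `[0, eps], continuous gamma} -> charts A c -> 0 < t < eps ->
  cdom c (gamma t) ->
  \forall s \near t, 0 < s < eps /\ cdom c (gamma s).
Proof.
move=> gc Ac te ct; have [[odom _] _ _ _ _] := chartsP Ac.
have It : nbhs t `]0, eps[%classic.
  by apply: open_nbhs_nbhs; split; [exact: itv_open|rewrite /= in_itv].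
have : {within `]0, eps[, continuous gamma}.
  by apply: continuous_subspaceW gc; exact: subset_itv_oo_cc.
rewrite continuous_open_subspace; last exact: itv_open.
move=> /(_ t); rewrite inE/= in_itv/= => /(_ te) gct.
have Dt : nbhs t (gamma @^-1` cdom c).
  by apply: gct; exact: open_nbhs_nbhs.
by apply: filterS2 It Dt => s /=; rewrite in_itv.
Qed.

(** The chain rule, in any chart c around gamma t: near t, f o gamma is the
    composite of the expressions of f and of gamma in c. *)
Lemma derive_along_curve (f : M -> R) (eps : R) (gamma : R -> M) (c : chart n M)
    (t : R) :
  C1_fun A f -> C1_curve A `]0, eps] gamma ->
  {within `[0, eps], continuous gamma} ->
  charts A c -> 0 < t < eps -> cdom c (gamma t) ->
  let w := cmap c \o gamma in
  [/\ derivable w t 1, {for t, continuous ('D_1 w)}, derivable (f \o gamma) t 1 &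
   'D_1 (f \o gamma) t = 'D_('D_1 w t) (f \o cinv c) (w t)].
Proof.
move=> fC1 [_ gC1] gc Ac te ct w.
have [_ _ cK _ _] := chartsP Ac.
have [dF _] := fC1 _ Ac.
have Dt := near_curve_chart gc Ac te ct.
have St : nbhs t (`]0, eps] `&` gamma @^-1` cdom c).
  apply: filterS Dt => s [/andP[s0 /ltW se] cs]; split => //=.
  by rewrite in_itv/= s0.
have [dw cw] := C1_within_interior St (gC1 _ Ac).
have dFt : differentiable (f \o cinv c) (w t) by apply: dF; exists (gamma t).
have fE : \forall s \near t, ((f \o cinv c) \o w) s = (f \o gamma) s.
  by apply: filterS Dt => s [_ cs]; rewrite /w /= cK.
have /derivable1_diffP dwd := dw.
have dFw : differentiable ((f \o cinv c) \o w) t by exact: differentiable_comp.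
split => //; first by apply: near_eq_derivable fE _; exact/derivable1_diffP.
by rewrite -(near_eq_derive _ fE) deriveE// diff_comp//= !deriveE.
Qed.

(** The chart must be kept fixed while the time varies.  In that chart the
    derivative is the sum, over the coordinates, of a component of the velocity
    times a partial derivative of f, and each factor is continuous. *)
Lemma continuous_derive_along_curve (f : M -> R) (eps : R) (gamma : R -> M)
    (t : R) :
  C1_fun A f -> C1_curve A `]0, eps] gamma ->
  {within `[0, eps], continuous gamma} -> 0 < t < eps ->
  {for t, continuous ('D_1 (f \o gamma))}.
Proof.
move=> fC1 gC1 gc te.
have Og : O (gamma t).
  by apply: gC1.1; rewrite /= in_itv/=; case/andP: te => -> /ltW.
have [Ac ct] := chart_atP A Og; set c := chart_at A (gamma t) in Ac ct.
have [dF cF] := fC1 _ Ac; have [_ ocim _ _ _] := chartsP Ac.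
pose w := cmap c \o gamma.
have Dt := near_curve_chart gc Ac te ct.
have [dw cw _ _] := derive_along_curve fC1 gC1 gc Ac te ct.
pose G s := \sum_(i < n) ('D_1 w s) 0 i * 'D_(delta_mx 0 i) (f \o cinv c) (w s).
have GE : \forall s \near t, G s = 'D_1 (f \o gamma) s.
  apply: filterS Dt => s [se cs].
  have [_ _ _ ->] := derive_along_curve fC1 gC1 gc Ac se cs.
  by rewrite derive_coordE//; apply: dF; exists (gamma s).
have Gt : G t = 'D_1 (f \o gamma) t by exact: nbhs_singleton GE.
rewrite /prop_for /continuous_at -Gt.
apply: cvg_trans (near_eq_cvg GE) _.
apply: cvg_big; first exact: add_continuous.
move=> i _; apply: cvgM.
  apply: (@continuous_comp _ _ _ ('D_1 w) (fun v : 'rV[R]_n => v 0 i)) => //.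
  exact: coord_continuous.
apply: (@continuous_comp _ _ _ w ('D_(delta_mx 0 i) (f \o cinv c))).
  by apply: differentiable_continuous; exact/derivable1_diffP.
have := cF (delta_mx 0 i); rewrite continuous_open_subspace//.
by apply; rewrite inE; exists (gamma t).
Qed.

(** In the preferred chart at gamma t, the chain rule expresses the derivative
    as the inner product of the gradient of f with the velocity of gamma. *)
Lemma derive_along_curve_bound (g : riemannian A) (f : M -> R) (eps : R)
    (gamma : R -> M) (t : R) :
  C1_fun A f -> C1_curve A `]0, eps] gamma ->
  {within `[0, eps], continuous gamma} -> 0 < t < eps ->
  `|'D_1 (f \o gamma) t| <=
    tnorm g (gamma t) (grad g f (gamma t)) * speed g `]0, eps] gamma t.
Proof.
move=> fC1 gC1 gc te.
have Og : O (gamma t).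
  by apply: gC1.1; rewrite /= in_itv/=; case/andP: te => -> /ltW.
have [Ac ct] := chart_atP A Og.
have [_ _ _ ->] := derive_along_curve fC1 gC1 gc Ac te ct.
have It : nbhs t `]0, eps]%classic.
  apply: filterS (near_curve_chart gc Ac te ct) => s [/andP[s0 /ltW se] _].
  by rewrite /= in_itv/= s0.
rewrite /speed vel_interior// -[X in `|X|]/(tdiff A f (gamma t) _).
rewrite -(grad_spec g)//.
by apply: mxform_cauchy_schwarz; [exact: gmx_sym|exact: gmx_pos].
Qed.

End curve_in_manifold.

Theorem lemma5p11 (R : realType) (n : nat) (M : metricType R) (Z : set M)
  (A : C1_atlas n (~` Z)) (g : riemannian A) (hM : rel_manifold g)
  (f : M -> R) (hf : rel_C1_fun A f)
  (rho : R) (hrho : 0 < rho)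
  (b : R -> R) (hbpos : forall t, 0 < t <= rho -> 0 < b t)
  (hbcont : {within `]0, rho], continuous b})
  (hbint : (\int[lebesgue_measure]_(t in `]0%R, rho]) ((b t)^-1)%:E)%E = +oo%E)
  (hgrad : forall x, 0 < f x < rho -> tnorm g x (grad g f x) <= b (f x))
  (p : M) (hp : boundary Z p) :
  ~ exists (eps : R) (gamma : R -> M),
      [/\ 0 < eps, rel_C1_curve A eps gamma, gamma 0 = p
        & rectifiable g eps gamma].
Proof.
case=> eps [gamma [eps0 [gc Z0 gC1] _]]; apply/negP; rewrite -leNgt leye_eq.
have [fc fZ fpos fC1] := hf.
have nZ t : 0 < t <= eps -> ~ Z (gamma t).
  by move=> te; apply: gC1.1; rewrite /= in_itv.
have s0 t : 0 <= speed g `]0, eps] gamma t by exact: sqrtr_ge0.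
apply/eqP.
apply: (osgood (b := b) (u := f \o gamma) (rho := rho) eps0) => //.
- by apply: within_continuous_comp gc => y _; exact: fc.
- by rewrite /= fZ.
- by move=> t /nZ; exact: fpos.
move=> t te; have /andP[t0 teps] := te.
have ft0 : 0 < f (gamma t) by apply/fpos/nZ; rewrite t0 ltW.
have nZt : ~ Z (gamma t) by apply: nZ; rewrite t0 ltW.
have [Ac ct] := chart_atP A nZt.
have [_ _ du _] := derive_along_curve fC1 gC1 gc Ac te ct.
have u'E : (f \o gamma)^`()%classic = 'D_1 (f \o gamma).
  by apply/funext => s; rewrite derive1E.
rewrite u'E; split => //.
  exact: continuous_derive_along_curve fC1 gC1 gc te.
move=> frho; apply: le_trans (derive_along_curve_bound g fC1 gC1 gc te) _.
by rewrite ler_wpM2r// hgrad// ft0.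
Qed.
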